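(* Let $\mathcal F_K$ be the vector-valued reproducing kernel Hilbert space associated to an $\mathbb R^{Q\times Q}$-valued kernel $K$ on a set $\mathcal X$. Let $\mathbf f,\mathbf f_0\in\mathcal F_K$, $\mathbf b\in\mathbb R^B$, $b_0\in\mathbb R$, $\boldsymbol\Gamma\in\mathbb R^{1\times B}$. Let $J_B,J_H\in\mathbb N$, let $\mathbf c_j\in\mathcal F_K$ and $r_j>0$ for $j\in[J_B]$, and let $\mathbf v_j\in\mathcal F_K\setminus\{\mathbf 0\}$ and $\rho_j\in\mathbb R$ for $j\in[J_H]$. Then the following statements are equivalent: 1. $$\emptyset\neq\Omega:=\Big(\bigcap_{j\in[J_B]}\mathring{\mathbb B}_K(\mathbf c_j,r_j)\Big)\cap\Big(\bigcap_{j\in[J_H]}\mathring H^-_K(\mathbf v_j,\rho_j)\Big)\subseteq H^+_K(\mathbf f-\mathbf f_0,\,b_0-\boldsymbol\Gamma\mathbf b)\neq\mathcal F_K.$$ 2. There exist $J_B$ functions $(\mathbf g_j)_{j\in[J_B]}\subset\operatorname{span}\big(\mathbf f-\mathbf f_0,\{\mathbf c_j\}_{j\in[J_B]},\{\mathbf v_j\}_{j\in[J_H]}\big)$ and $J_H$ non-negative coefficients $(\xi_j)_{j\in[J_H]}\in[0,\infty)^{J_H}$ such that $$-b_0+\boldsymbol\Gamma\mathbf b+\sum_{j\in[J_B]}\langle\mathbf g_j,\mathbf c_j\rangle_K-\sum_{j\in[J_H]}\xi_j\rho_j-\sum_{j\in[J_B]}r_j\|\mathbf g_j\|_K\ge 0,$$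 $$-(\mathbf f-\mathbf f_0)+\sum_{j\in[J_B]}\mathbf g_j-\sum_{j\in[J_H]}\xi_j\mathbf v_j=\mathbf 0 .$$
   Context: $\mathbb N=\{0,1,\dots\}$, $[n]=\{1,\dots,n\}$ with $[0]=\emptyset$ (an empty intersection is $\mathcal F_K$). A matrix-valued kernel $K:\mathcal X\times\mathcal X\to\mathbb R^{Q\times Q}$ satisfies $K(\mathbf x,\mathbf x')=K(\mathbf x',\mathbf x)^\top$ and $\sum_{i,j}\mathbf v_i^\top K(\mathbf x_i,\mathbf x_j)\mathbf v_j\ge0$ for all finite families; its RKHS $\mathcal F_K$ (inner product $\langle\cdot,\cdot\rangle_K$, norm $\|\cdot\|_K$) is the Hilbert space of functions $\mathcal X\to\mathbb R^Q$ containing all $K(\cdot,\mathbf x)\mathbf c$ and satisfying $\langle\mathbf f,K(\cdot,\mathbf x)\mathbf c\rangle_K=\langle\mathbf f(\mathbf x),\mathbf c\rangle$. $\mathring{\mathbb B}_K(\mathbf c,r)=\{\mathbf g\in\mathcal F_K:\|\mathbf g-\mathbf c\|_K<r\}$; $\mathring H^-_K(\mathbf v,\rho)=\{\mathbf g\in\mathcal F_K:\langle\mathbf v,\mathbf g\rangle_K<\rho\}$; $H^+_K(\mathbf h,\rho)=\{\mathbf g\in\mathcal F_K:\langle\mathbf h,\mathbf g\rangle_K\ge\rho\}$.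
   Formalization: The formal theorem assumes throughout that Ω is nonempty and H⁺_K(f−f₀, b₀−Γb) ≠ F_K; without this 2⇒1 fails, e.g. J_B = J_H = 0, f = f₀, b₀ = Γb = 0, where statement 2 holds but H⁺_K = F_K. *)

(* Defs.v *)
From HB Require Import structures.
From mathcomp Require Import all_boot all_order all_algebra.
From mathcomp Require Import all_classical all_reals all_analysis.

Set Implicit Arguments.
Unset Strict Implicit.
Unset Printing Implicit Defensive.

Import Order.TTheory GRing.Theory Num.Theory.
Import numFieldNormedType.Exports.

Local Open Scope classical_set_scope.
Local Open Scope ring_scope.

Definition matrix_kernel (R : realType) (X : Type) (Q : nat)
    (K : X -> X -> 'M[R]_Q) : Prop :=
  (forall x x', K x x' = (K x' x)^T) /\
  (forall (n : nat) (x : 'I_n -> X) (v : 'I_n -> 'cV[R]_Q),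
     0 <= \sum_(i < n) \sum_(j < n) ((v i)^T *m K (x i) (x j) *m v j) 0 0).

(* For theta := idfun, [{dot V for theta}] is the type of real inner products
   (symmetric positive definite bilinear forms) on V. *)
Definition dot_norm (R : realType) (V : lmodType R) (dot : {dot V for idfun})
    (u : V) : R :=
  Num.sqrt (dot u u).

Definition dot_complete (R : realType) (V : lmodType R)
    (dot : {dot V for idfun}) : Prop :=
  forall u : nat -> V,
    (forall e : R, 0 < e ->
       exists N : nat, forall m n : nat, (N <= m)%N -> (N <= n)%N ->
         dot_norm dot (u m - u n) < e) ->
    exists l : V, dot_norm dot (u n - l) @[n --> \oo] --> (0 : R).

(* A Hilbert space of functions X -> R^Q is carried by a type whose elements
   are identified with functions through a linear injection [rkhs_fun];
   [rkhs_ker F x c] is the element K(., x) c.  For a given kernel these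
   conditions determine the space up to a unique isometry commuting with
   [rkhs_fun] (Moore-Aronszajn). *)
Record rkhs (R : realType) (X : Type) (Q : nat) (K : X -> X -> 'M[R]_Q) := Rkhs {
  rkhs_sort :> lmodType R;
  rkhs_dot : {dot rkhs_sort for idfun};
  rkhs_fun : {linear rkhs_sort -> (X -> 'cV[R]_Q)};
  rkhs_fun_inj : injective rkhs_fun;
  rkhs_complete : dot_complete rkhs_dot;
  rkhs_ker : X -> 'cV[R]_Q -> rkhs_sort;
  rkhs_kerE : forall x c, rkhs_fun (rkhs_ker x c) = (fun x' => K x' x *m c);
  rkhs_reproducing : forall (f : rkhs_sort) x c,
    rkhs_dot f (rkhs_ker x c) = ((rkhs_fun f x)^T *m c) 0 0
}.

Notation "''<' u , v >_K" := (@rkhs_dot _ _ _ _ _ u v)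
  (at level 0, u, v at level 200, format "''<' u ,  v >_K") : ring_scope.
Notation "''|' u |_K" := (dot_norm (@rkhs_dot _ _ _ _ _) u)
  (at level 0, u at level 200, format "''|' u |_K") : ring_scope.

Section SetsOfRkhs.
Variables (R : realType) (X : Type) (Q : nat) (K : X -> X -> 'M[R]_Q).
Variable F : rkhs K.

Definition open_ball_K (c : F) (r : R) : set F := [set g | '|g - c|_K < r].

Definition open_halfspace_K (v : F) (rho : R) : set F :=
  [set g | '<v, g>_K < rho].

Definition closed_halfspace_K (h : F) (rho : R) : set F :=
  [set g | '<h, g>_K >= rho].

End SetsOfRkhs.

Definition lin_span (R : realType) (V : lmodType R) (A : set V) : set V :=
  [set g | exists (n : nat) (a : 'I_n -> R) (u : 'I_n -> V),
     (forall i, A (u i)) /\ g = \sum_(i < n) a i *: u i].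

(* Main.v *)
(* Statement 2 gives statement 1 by the Cauchy-Schwarz inequality on each ball.
   For the converse, write the balls as the sublevel sets of the quadratic
   functions [|x - c_j|^2 - r_j^2].  A point of Omega is a Slater point, so
   convex Lagrange duality (an induction on the constraints, each step being a
   one-dimensional convexity argument) yields multipliers for which
   [<h, x> - beta + sum_j lam_j (|x - c_j|^2 - r_j^2)
     + sum_j xi_j (<v_j, x> - rho_j)]
   is nonnegative for all x.  If the [lam_j] do not all vanish, this quadratic
   function has an explicit minimiser [x], which lies in the span; if they do,
   its linear part is zero.  Taking [g_j = 2 lam_j (c_j - x)] ([0] in the second
   case), stationarity is the vector equation and nonnegativity of the minimum
   is the scalar inequality. *)

Require Import Defs.
From HB Require Import structures.
From mathcomp Require Import all_boot all_order all_algebra.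
From mathcomp Require Import all_classical all_reals all_analysis.
From mathcomp Require Import ring lra.

Import Order.TTheory GRing.Theory Num.Theory.
Import numFieldNormedType.Exports.

Local Open Scope classical_set_scope.
Local Open Scope ring_scope.

Set Implicit Arguments.
Unset Strict Implicit.

(** * Lagrange multipliers for strict convex inequalities *)

Section ConvexDuality.
Variables (R : realType) (V : lmodType R).
Implicit Types (C : set V) (L phi : V -> R).

Definition convex_subset C := forall a b x y,
  0 <= a -> 0 <= b -> a + b = 1 -> C x -> C y -> C (a *: x + b *: y).

Definition convex_real_fun phi := forall a b x y,
  0 <= a -> 0 <= b -> a + b = 1 ->
  phi (a *: x + b *: y) <= a * phi x + b * phi y.

Lemma convex_real_funD L phi :
  convex_real_fun L -> convex_real_fun phi -> convex_real_fun (L \+ phi).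
Proof.
move=> hL hphi a b x y a0 b0 ab /=.
have := hL a b x y a0 b0 ab; have := hphi a b x y a0 b0 ab; lra.
Qed.

Lemma convex_real_fun_sum m (lam : 'I_m -> R) (phi : 'I_m -> V -> R) :
  (forall i, 0 <= lam i) -> (forall i, convex_real_fun (phi i)) ->
  convex_real_fun (fun x => \sum_(i < m) lam i * phi i x).
Proof.
move=> lam0 hphi a b x y a0 b0 ab; rewrite !mulr_sumr -big_split /=.
apply: ler_sum => i _; have := hphi i a b x y a0 b0 ab.
move=> /(ler_wpM2l (lam0 i)); lra.
Qed.

Lemma conv_lt0 (a b s t : R) : 0 <= a -> 0 <= b -> a + b = 1 ->
  s < 0 -> t < 0 -> a * s + b * t < 0.
Proof.
rewrite le_eqVlt => /orP[/eqP <-|a0] b0 ab s0 t0; last by nra.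
by rewrite add0r in ab; rewrite ab mul0r add0r mul1r.
Qed.

Lemma convex_sublevel C phi : convex_subset C -> convex_real_fun phi ->
  convex_subset (C `&` [set x | phi x < 0]).
Proof.
move=> hC hphi a b x y a0 b0 ab [Cx /= px] [Cy /= py]; split; first exact: hC.
by apply: (le_lt_trans (hphi a b x y a0 b0 ab)); exact: conv_lt0.
Qed.

(** On the segment from [x] to [y], the chord of [phi] is negative just past its zero, so [L], and
    hence its chord, is nonnegative there. Clearing denominators in the limit gives the claim. *)
Lemma convex_cross C L phi x y :
  convex_subset C -> convex_real_fun L -> convex_real_fun phi ->
  (forall z, C z -> phi z < 0 -> 0 <= L z) ->
  C x -> C y -> 0 <= phi x -> phi y < 0 ->
  0 <= phi x * L y - phi y * L x.
Proof.
move=> hC hL hphi pos Cx Cy px py; have Ly := pos y Cy py.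
(* The weights make [phi] at most [e phi y / d < 0] at the combination. *)
have key e : 0 < e -> 0 <= (phi x + e) * L y - phi y * L x.
  move=> e0; set d := phi x + e - phi y.
  have d0 : 0 < d by rewrite /d; lra.
  have dn0 : d != 0 by rewrite gt_eqF.
  pose a := - phi y / d; pose b := (phi x + e) / d.
  have a0 : 0 <= a by rewrite divr_ge0 ?ltW// oppr_gt0.
  have b0 : 0 <= b by rewrite divr_ge0 ?ltW//; lra.
  have ab : a + b = 1.
    by rewrite -mulrDl [_ + _]addrC divff.
  have := pos _ (hC _ _ _ _ a0 b0 ab Cx Cy).
  have -> : phi (a *: x + b *: y) < 0.
    apply: (le_lt_trans (hphi _ _ x y a0 b0 ab)).
    have -> : a * phi x + b * phi y = e * phi y / d by rewrite /a /b; ring.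
    by rewrite pmulr_llt0 ?invr_gt0// pmulr_rlt0.
  move=> /(_ isT) /le_trans /(_ (hL _ _ x y a0 b0 ab)).
  have -> : a * L x + b * L y = ((phi x + e) * L y - phi y * L x) / d.
    by rewrite /a /b; ring.
  by rewrite pmulr_lge0 ?invr_gt0.
(* Let [e] tend to 0: if the value [q] were negative, an [e] with [e * (L y + 1) = - q / 2] would
   contradict [key]. The [+ 1] covers [L y = 0]. *)
rewrite leNgt; apply/negP => neg.
set q := phi x * L y - phi y * L x in neg.
have := key (- q / (L y + 1) / 2).
have -> : 0 < - q / (L y + 1) / 2 by rewrite !divr_gt0 ?oppr_gt0 //; lra.
move=> /(_ isT); set e := _ / 2 => he.
have ee : e * (L y + 1) = - q / 2 by rewrite /e; field; rewrite gt_eqF//; lra.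
have e0 : 0 < e by rewrite /e !divr_gt0 ?oppr_gt0 //; lra.
move: he ee neg; rewrite /q; nra.
Qed.

(** Points with [phi < 0] bound the multiplier above by [L y / - phi y], points with [phi > 0] bound
    it below by [- L x / phi x], and [convex_cross] puts the lower bounds under the upper ones. The
    infimum of the upper bounds therefore works; the Slater point [x0] makes their set nonempty and
    settles [phi x = 0]. *)
Lemma lagrange_multiplier C L phi x0 :
  convex_subset C -> convex_real_fun L -> convex_real_fun phi ->
  C x0 -> phi x0 < 0 -> (forall z, C z -> phi z < 0 -> 0 <= L z) ->
  exists2 lam : R, 0 <= lam & forall x, C x -> 0 <= L x + lam * phi x.
Proof.
move=> hC hL hphi Cx0 px0 pos.
pose S := [set L y / - phi y | y in C `&` [set y | phi y < 0]].
have S0 : S !=set0 by exists (L x0 / - phi x0); exists x0.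
have S_ge0 : lbound S 0.
  by move=> _ [y [Cy /= py] <-]; rewrite divr_ge0 ?pos// oppr_ge0 ltW.
exists (inf S); first exact: lb_le_inf.
move=> x Cx; have [px|px|px] := ltgtP (phi x) 0.
- have : inf S <= L x / - phi x.
    by apply: ge_inf; [exists 0 | exists x].
  rewrite ler_pdivlMr ?oppr_gt0//; lra.
- have : - L x / phi x <= inf S.
    apply: lb_le_inf => // _ [y [Cy /= py] <-].
    rewrite ler_pdivrMr// mulrAC ler_pdivlMr ?oppr_gt0//.
    have := convex_cross hC hL hphi pos Cx Cy (ltW px) py; lra.
  rewrite ler_pdivrMr//; lra.
- have := convex_cross hC hL hphi pos Cx Cx0 _ px0; rewrite px lexx => /(_ isT).
  rewrite mul0r sub0r mulr0 addr0 -mulNr pmulr_rge0 ?oppr_gt0//.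
Qed.

(** Induction on [m]: the first constraint is moved into the domain while the others receive
    multipliers, then it is dualised against the resulting Lagrangian. *)
Lemma lagrange_multipliers m (phi : 'I_m -> V -> R) C L x0 :
  convex_subset C -> convex_real_fun L ->
  (forall i, convex_real_fun (phi i)) ->
  C x0 -> (forall i, phi i x0 < 0) ->
  (forall z, C z -> (forall i, phi i z < 0) -> 0 <= L z) ->
  exists2 lam : 'I_m -> R, forall i, 0 <= lam i &
    forall x, C x -> 0 <= L x + \sum_(i < m) lam i * phi i x.
Proof.
elim: m => [|m IHm] in phi C L *; move=> hC hL hphi Cx0 px0 pos.
  exists (fun=> 0) => // x Cx; rewrite big_ord0 addr0.
  by apply: pos => // - [].
have [|lam' lam'0 Hlam'] := IHm (phi \o lift ord0)
  (C `&` [set x | phi ord0 x < 0]) L (convex_sublevel hC (hphi ord0)) hL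
  (fun i => hphi _) (conj Cx0 (px0 ord0)) (fun i => px0 _).
  move=> z [Cz /= pz] pz'; apply: pos => // i.
  by case: (unliftP ord0 i) => [j ->|->//]; exact: pz'.
have hL' := convex_real_funD hL
  (convex_real_fun_sum lam'0 (fun i => hphi (lift ord0 i))).
have [|lam lam0 Hlam] := lagrange_multiplier hC hL' (hphi ord0) Cx0 (px0 ord0).
  by move=> z Cz pz; exact: Hlam'.
exists (fun i => if unlift ord0 i is Some j then lam' j else lam).
  by move=> i; case: unlift.
move=> x Cx; rewrite big_ord_recl unlift_none.
under eq_bigr do rewrite liftK.
by have := Hlam x Cx; rewrite /= addrAC addrA.
Qed.

End ConvexDuality.

(** * Closure properties of the linear span *)

Section LinSpan.
Variables (R : realType) (V : lmodType R) (A : set V).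

Lemma lin_span_gen x : A x -> lin_span A x.
Proof.
by move=> Ax; exists 1, (fun=> 1), (fun=> x); rewrite big_ord1 scale1r.
Qed.

Lemma lin_span0 : lin_span A 0.
Proof.
by exists 0, (fun=> 0), (fun=> 0); rewrite big_ord0; split=> // - [].
Qed.

Lemma lin_spanZ k x : lin_span A x -> lin_span A (k *: x).
Proof.
move=> [n [a [u [Au ->]]]]; exists n, (fun i => k * a i), u; split=> //.
by rewrite scaler_sumr; apply: eq_bigr => i _; rewrite scalerA.
Qed.

Lemma lin_spanD x y : lin_span A x -> lin_span A y -> lin_span A (x + y).
Proof.
move=> [n [a [u [Au ->]]]] [m [a' [u' [Au' ->]]]].
exists (n + m)%N,
  (fun i => match fintype.split i with inl j => a j | inr k => a' k end),
  (fun i => match fintype.split i with inl j => u j | inr k => u' k end); split.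
  by move=> i; case: fintype.split.
rewrite big_split_ord /=; congr (_ + _); apply: eq_bigr => i _.
- by rewrite (unsplitK (inl i)).
- by rewrite (unsplitK (inr i)).
Qed.

Lemma lin_spanB x y : lin_span A x -> lin_span A y -> lin_span A (x - y).
Proof.
by move=> Ax Ay; rewrite -scaleN1r; apply: lin_spanD => //; exact: lin_spanZ.
Qed.

Lemma lin_span_sum m (u : 'I_m -> V) :
  (forall i, lin_span A (u i)) -> lin_span A (\sum_(i < m) u i).
Proof.
move=> Au; apply: big_ind => //; [exact: lin_span0 | exact: lin_spanD].
Qed.

End LinSpan.

(** * Inner product geometry and minimisation of the Lagrangian *)

Section DotProduct.
Variables (R : realType) (V : lmodType R) (dot : {dot V for idfun}).
Implicit Types u v w c : V.

Lemma dotC u w : dot u w = dot w u.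
Proof. by rewrite hermC expr0 mul1r. Qed.

Lemma dotZl a u w : dot (a *: u) w = a * dot u w.
Proof. exact: linearZl_LR. Qed.

Lemma dotZr a u w : dot u (a *: w) = a * dot u w.
Proof. exact: linearZr_LR. Qed.

Lemma dot_ge0 u : 0 <= dot u u.
Proof.
have [->|u0] := eqVneq u 0; first by rewrite linear0r.
exact/ltW/neq0_dnorm_gt0.
Qed.

Lemma dot_eq0 u : dot u u = 0 -> u = 0.
Proof.
have [//|u0] := eqVneq u 0.
have : 0 < dot u u by exact: neq0_dnorm_gt0.
by move=> /[swap] ->; rewrite ltxx.
Qed.

Lemma dot_norm_ge0 u : 0 <= dot_norm dot u.
Proof. exact: sqrtr_ge0. Qed.

Lemma dot_norm_sqr u : dot_norm dot u ^+ 2 = dot u u.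
Proof. by rewrite sqr_sqrtr ?dot_ge0. Qed.

Lemma dot_norm_lt u r : 0 < r -> (dot_norm dot u < r) = (dot u u - r ^+ 2 < 0).
Proof.
move=> r0; rewrite subr_lt0 -dot_norm_sqr.
by rewrite ltr_pXn2r ?nnegrE ?dot_norm_ge0// ltW.
Qed.

(** With [p], [q] the norms of [u], [w], the square of [q *: u + p *: w] is
    [2 * (p * q) * (dot u w + p * q)]. *)
Lemma dot_cauchy_schwarz u w : - (dot_norm dot u * dot_norm dot w) <= dot u w.
Proof.
have [->|u0] := eqVneq u 0.
  by rewrite linear0l oppr_le0 mulr_ge0 ?dot_norm_ge0.
have [->|w0] := eqVneq w 0.
  by rewrite linear0r oppr_le0 mulr_ge0 ?dot_norm_ge0.
set p := dot_norm dot u; set q := dot_norm dot w.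
have p0 : 0 < p by rewrite sqrtr_gt0; exact: neq0_dnorm_gt0.
have q0 : 0 < q by rewrite sqrtr_gt0; exact: neq0_dnorm_gt0.
have := dot_ge0 (q *: u + p *: w).
rewrite linearDl /= !linearDr /= !dotZl !dotZr.
rewrite (dotC w u) -!dot_norm_sqr -/p -/q.
rewrite (_ : _ + _ = 2 * (p * q) * (dot u w + p * q)); last by ring.
rewrite pmulr_rge0 ?mulr_gt0//; lra.
Qed.

Lemma convex_dot_affine u k : convex_real_fun (fun x => dot u x - k).
Proof.
move=> a b x y a0 b0 ab; rewrite linearDr /= !dotZr.
have -> : b = 1 - a by lra. lra.
Qed.

(** With [s = x - c] and [t = y - c], the convexity gap is [a * b] times the square of [s - t]. *)
Lemma convex_dot_sqr c k : convex_real_fun (fun x => dot (x - c) (x - c) - k).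
Proof.
move=> a b x y a0 b0 ab.
have -> : a *: x + b *: y - c = a *: (x - c) + b *: (y - c).
  by rewrite !scalerBr addrACA -opprD -scalerDl ab scale1r.
have := dot_ge0 ((x - c) - (y - c)).
move: (x - c) (y - c) => s t.
rewrite linearBl /= !linearBr /= linearDl /= !linearDr /=.
rewrite !dotZl !dotZr.
rewrite (dotC t s) => /(mulr_ge0 (mulr_ge0 a0 b0)).
have -> : b = 1 - a by lra. lra.
Qed.

Lemma dot_affine_ge0 u k : (forall x, 0 <= dot u x + k) -> u = 0.
Proof.
move=> H; apply: dot_eq0; apply/eqP; rewrite eq_le dot_ge0 andbT leNgt.
(* At this point the affine function takes the value -1. *)
apply/negP => u0; have := H (- ((k + 1) / dot u u) *: u).
by rewrite dotZr mulNr divfK ?gt_eqF//; lra.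
Qed.


Lemma dot_normZ a u : 0 <= a -> dot_norm dot (a *: u) = a * dot_norm dot u.
Proof.
move=> a0; rewrite /dot_norm dotZl dotZr mulrA -expr2.
by rewrite sqrtrM ?sqr_ge0// sqrtr_sqr ger0_norm.
Qed.

(* The [g j] are the gradients, up to sign, of the quadratic terms at the
   minimiser of the Lagrangian; AM-GM turns the squared radii into norms. *)
Lemma quadratic_lagrangian_split m (A : set V) (c : 'I_m -> V)
    (r lam : 'I_m -> R) w k :
  lin_span A w -> (forall j, lin_span A (c j)) -> (forall j, 0 <= lam j) ->
  (forall x, 0 <= dot w x - k +
    \sum_(j < m) lam j * (dot (x - c j) (x - c j) - r j ^+ 2)) ->
  exists g : 'I_m -> V, [/\ forall j, lin_span A (g j), \sum_(j < m) g j = w &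
    0 <= \sum_(j < m) dot (g j) (c j) - k -
         \sum_(j < m) r j * dot_norm dot (g j)].
Proof.
move=> Aw Ac lam0 H; set s := \sum_(j < m) lam j.
have [s0|s0] := eqVneq s 0.
  have lam_eq0 j : lam j = 0 by exact: (psumr_eq0P (fun i _ => lam0 i) s0).
  have Hw x : 0 <= dot w x + (- k).
    have := H x; rewrite big1 ?addr0// => j _.
    by rewrite lam_eq0 mul0r.
  have w0 := dot_affine_ge0 Hw.
  exists (fun=> 0); split; first by move=> _; exact: lin_span0.
    by rewrite w0 big1.
  have := Hw 0; rewrite linear0r add0r !big1 ?add0r ?subr0// => j _.
    by rewrite /dot_norm linear0r sqrtr0 mulr0.
  by rewrite linear0l.
(* The zero of the gradient [w + 2 sum_j lam_j (x - c_j)]. *)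
pose x := s^-1 *: (\sum_(j < m) lam j *: c j - 2^-1 *: w).
have Ax : lin_span A x.
  apply/lin_spanZ/lin_spanB; last exact: lin_spanZ.
  by apply: lin_span_sum => j; exact: lin_spanZ.
pose g j := (2 * lam j) *: (c j - x).
have gw : \sum_(j < m) g j = w.
  under eq_bigr do rewrite /g -scalerA scalerBr.
  rewrite -scaler_sumr big_split /= sumrN -scaler_suml -/s.
  by rewrite scalerA divff// scale1r opprB addrC subrK scalerA divff ?scale1r.
exists g; split => //.
  by move=> j; exact/lin_spanZ/lin_spanB.
have := H x; rewrite -{1}gw linear_sumlz.
have : \sum_(j < m) dot (g j) x +
    \sum_(j < m) lam j * (dot (x - c j) (x - c j) - r j ^+ 2) <=
    \sum_(j < m) dot (g j) (c j) - \sum_(j < m) r j * dot_norm dot (g j).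
  rewrite -sumrN -!big_split /=; apply: ler_sum => j _.
  rewrite /g dot_normZ ?mulr_ge0//.
  rewrite -[x - c j]opprB linearNl linearNr /= opprK -dot_norm_sqr.
  set d := dot_norm dot _.
  have -> : dot ((2 * lam j) *: (c j - x)) (c j) =
            dot ((2 * lam j) *: (c j - x)) x + 2 * lam j * d ^+ 2.
    rewrite /d dot_norm_sqr -dotZl.
    by rewrite -linearDr [x + _]addrC subrK.
  (* The norm of [g j] is [2 * lam j * d], so the two sides differ by exactly this square term. *)
  have := mulr_ge0 (lam0 j) (sqr_ge0 (d - r j)); lra.
lra.
Qed.

End DotProduct.

(* The implication 2 -> 1 fails when Omega is empty or when the closed
   half-space is the whole space: both are standing hypotheses here. *)
Theorem theorem2 (R : realType) (X : Type) (Q : nat) (K : X -> X -> 'M[R]_Q)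
    (hK : matrix_kernel K) (F : rkhs K) (f f0 : F)
    (B : nat) (b : 'cV[R]_B) (b0 : R) (Gamma : 'rV[R]_B)
    (JB JH : nat)
    (c : 'I_JB -> F) (r : 'I_JB -> R) (hr : forall j, 0 < r j)
    (v : 'I_JH -> F) (hv : forall j, v j != 0) (rho : 'I_JH -> R) :
  let Omega : set F :=
    (\bigcap_(j in [set: 'I_JB]) open_ball_K (c j) (r j)) `&`
    (\bigcap_(j in [set: 'I_JH]) open_halfspace_K (v j) (rho j)) in
  let Hplus : set F :=
    closed_halfspace_K (f - f0) (b0 - (Gamma *m b) 0 0) in
  Omega <> set0 -> Hplus <> [set: F] ->
  ([/\ Omega <> set0, Omega `<=` Hplus & Hplus <> [set: F]]
   <->
   exists (g : 'I_JB -> F) (xi : 'I_JH -> R),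
     [/\ forall j, lin_span ([set f - f0] `|` range c `|` range v) (g j),
         forall j, 0 <= xi j,
         0 <= - b0 + (Gamma *m b) 0 0 + \sum_(j < JB) '<g j, c j>_K
              - \sum_(j < JH) xi j * rho j - \sum_(j < JB) r j * '|g j|_K
       & - (f - f0) + \sum_(j < JB) g j - \sum_(j < JH) xi j *: v j = 0]).
Proof.
move=> Omega Hplus Omega0 HplusT.
set h := f - f0; set beta := b0 - (Gamma *m b) 0 0.
set dot := @rkhs_dot _ _ _ _ F.
split=> [[_ sub _]|[g [xi [_ xi0 ineq eq0]]]]; last first.
  split=> // x [xB xH]; rewrite /Hplus /closed_halfspace_K /= -/h -/beta -/dot.
  have -> : h = \sum_(j < JB) g j - \sum_(j < JH) xi j *: v j.
    by apply/esym/eqP; rewrite -subr_eq0 addrC addrA; exact/eqP.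
  rewrite linearBl /= !linear_sumlz.
  (* Each term on the left is the minimum of [dot (g j)] over the closed ball of centre [c j] and
     radius [r j]. *)
  have : \sum_(j < JB) dot (g j) (c j) -
      \sum_(j < JB) r j * dot_norm dot (g j) <= \sum_(j < JB) dot (g j) x.
    rewrite -sumrN -big_split /=; apply: ler_sum => j _.
    have := dot_cauchy_schwarz dot (g j) (x - c j).
    have : dot_norm dot (x - c j) <= r j by exact/ltW/(xB j I).
    move=> /(ler_wpM2l (dot_norm_ge0 dot (g j))).
    rewrite linearBr /=; lra.
  have : \sum_(j < JH) dot (xi j *: v j) x <= \sum_(j < JH) xi j * rho j.
    apply: ler_sum => j _; rewrite dotZl.
    exact/ler_wpM2l/ltW/(xH j I).
  move: ineq; rewrite -/dot /beta; lra.
have [x0 [x0B x0H]] : Omega !=set0 by exact/set0P/eqP.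
pose ballf j x := dot (x - c j) (x - c j) - r j ^+ 2.
pose halff j x := dot (v j) x - rho j.
pose L x := dot h x - beta.
have ballE j x : (open_ball_K (c j) (r j) x) <-> (ballf j x < 0).
  by rewrite /open_ball_K /= dot_norm_lt.
have halfE j x : (open_halfspace_K (v j) (rho j) x) <-> (halff j x < 0).
  by rewrite /open_halfspace_K /= subr_lt0.
have Lcvx : convex_real_fun L by exact: convex_dot_affine.
have Bcvx j : convex_real_fun (ballf j) by exact: convex_dot_sqr.
have Hcvx j : convex_real_fun (halff j) by exact: convex_dot_affine.
(* Duality is applied twice: first to the balls over the domain [C] cut out by the half-spaces, then
   to the half-spaces over the whole space. *)
pose C := [set x | forall j, halff j x < 0].
have Ccvx : convex_subset C.
  move=> a d x y a0 d0 ad Cx Cy j.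
  by apply: (le_lt_trans (Hcvx j a d x y a0 d0 ad)); exact: conv_lt0.
have [j|j|z Cz Bz|lam lam0 Hlam] :=
  lagrange_multipliers (x0 := x0) Ccvx Lcvx Bcvx.
- exact/halfE/x0H.
- exact/ballE/x0B.
- rewrite /L subr_ge0; apply: sub.
  by split=> j _; [apply/ballE/Bz | apply/halfE/Cz].
have LBcvx := convex_real_funD Lcvx (convex_real_fun_sum lam0 Bcvx).
have [||j|z _ /Hlam//|xi xi0 Hxi] :=
  lagrange_multipliers (C := setT) (x0 := x0) _ LBcvx Hcvx.
- by [].
- by [].
- exact/halfE/x0H.
pose A : set F := [set h] `|` range c `|` range v.
have Ah : lin_span A h by apply: lin_span_gen; left; left.
have Ac j : lin_span A (c j) by apply: lin_span_gen; left; right; exists j.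
have Av j : lin_span A (v j) by apply: lin_span_gen; right; exists j.
(* The half-space terms are affine, so they are absorbed into the linear part and the constant. *)
have [||//|x|g [Ag gE ineq]] := @quadratic_lagrangian_split _ _ dot _ A c r lam
  (h + \sum_(j < JH) xi j *: v j) (beta + \sum_(j < JH) xi j * rho j).
- apply: lin_spanD => //; apply: lin_span_sum => j; exact: lin_spanZ.
- exact: Ac.
- have := Hxi x I; rewrite /L /halff /ballf /=.
  under [X in _ + X]eq_bigr do rewrite mulrBr -dotZl.
  rewrite sumrB -linear_sumlz [dot (h + _) x]linearDl /=; lra.
exists g, xi; split => //; first by move: ineq; rewrite /beta; lra.
by rewrite gE addKr subrr.
Qed.
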